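(* Let $k\ge 0$ be an integer and let $(f_h^m,E_h^m)_{m=0}^{M}$ be generated by the (second-order, Strang-splitting) ECSLDG method with polynomial degree $k$ for the 1D1V Vlasov-Ampère system, periodic in $x$, on $[0,L]\times[-v_m,v_m]$. Then the total particle number is preserved: for every $m=0,1,\dots,M-1$, $$\int_0^L\int_{-v_m}^{v_m} f_h^{m+1}(x,v)\,dv\,dx=\int_0^L\int_{-v_m}^{v_m} f_h^{m}(x,v)\,dv\,dx .$$
   Context: Continuous problem (dimensionless, electrons only): $\partial_t f+v\,\partial_x f-E\,\partial_v f=0$, $\lambda^2\partial_t E=-J$ with $J=-\int f v\,dv$, $\lambda>0$ constant, periodic in $x\in[0,L]$, velocity domain $[-v_m,v_m]$. (In the symbol $v_m$ for the velocity cutoff, the subscript is not the time index.) Mesh and spaces. $0=x_{1/2}<\dots<x_{N_x+1/2}=L$, $X_i=[x_{i-1/2},x_{i+1/2}]$; $-v_m=v_{1/2}<\dots<v_{N_v+1/2}=v_m$, $V_j=[v_{j-1/2},v_{j+1/2}]$. $\mathcal D_k(\mathcal E_x)$ (resp. $\mathcal D_k(\mathcal E_v)$) is the space of functions, possibly discontinuous at cell interfaces, whose restriction to each $X_i$ (resp. $V_j$) is a polynomial of degree at most $k$; $Q^k=\mathcal D_k(\mathcal E_x)\otimes\mathcal D_k(\mathcal E_v)$. On each $X_i$ (resp. $V_j$) let $x_{i,p}$ with weights $w_{i,p}$, $p=1,\dots,k+1$ (resp. $v_{j,q}$ with weights $w_{j,q}$, $q=1,\dots,k+1$) be the $(k+1)$-point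 Gauss-Legendre nodes and weights of that cell, so quadrature is exact for polynomials of degree less than $2k+2$. An element of $Q^k$ is determined by its values at all nodes $(x_{i,p},v_{j,q})$, equivalently by its restrictions to all lines $v=v_{j,q}$, or to all lines $x=x_{i,p}$. An element of $\mathcal D_k(\mathcal E_x)$ is determined by its values at all $x_{i,p}$. Functions of $x$ are extended $L$-periodically; functions of $v$ are extended by zero outside $[-v_m,v_m]$. ECSLDG method. Time step $\Delta t>0$. Given $f_h^m\in Q^k$ and $E_h^m\in\mathcal D_k(\mathcal E_x)$, define $f_h^{m+1}\in Q^k$, $E_h^{m+1}\in\mathcal D_k(\mathcal E_x)$ by three steps. Step 1: for each $(j,q)$, $f_h^*(\cdot,v_{j,q})\in\mathcal D_k(\mathcal E_x)$ is defined by $$\int_{X_i} f_h^*(x,v_{j,q})\Psi(x)\,dx=\int_{X_i^\star} f_h^m(x,v_{j,q})\Psi(x+v_{j,q}\Delta t/2)\,dx,\quad X_i^\star=X_i-v_{j,q}\Delta t/2,$$ for all $i$ and all $\Psi\in\mathcal D_k(\mathcal E_x)$ (in the right-hand integral, $\Psi$ is evaluated at points of the cell $X_i$). This determines $f_h^*\in Q^k$. Step 2: for each $(i,p)$ let $n_h^*(x_{i,p})=\sum_{j,q}w_{j,q}f_h^*(x_{i,p},v_{j,q})$, $J_h^*(x_{i,p})=-\sum_{j,q}w_{j,q}f_h^*(x_{i,p},v_{j,q})v_{j,q}$, $\theta(x_{i,p})=\frac{\Delta t^2}{4}n_h^*(x_{i,p})$, $$E_h^{m+1}(x_{i,p})=\frac{\lambda^2-\theta(x_{i,p})}{\lambda^2+\theta(x_{i,p})}E_h^m(x_{i,p})-\frac{\Delta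 t}{\lambda^2+\theta(x_{i,p})}J_h^*(x_{i,p}),\quad E_h^{m+1/2}=\tfrac12(E_h^m+E_h^{m+1}),$$ where it is assumed that $\lambda^2+\theta(x_{i,p})\neq 0$, so that the update is defined. Then $f_h^{**}(x_{i,p},\cdot)\in\mathcal D_k(\mathcal E_v)$ is defined by $$\int_{V_j} f_h^{**}(x_{i,p},v)\Psi(v)\,dv=\int_{V_j^\star} f_h^*(x_{i,p},v)\Psi(v-E_h^{m+1/2}(x_{i,p})\Delta t)\,dv,\quad V_j^\star=V_j+E_h^{m+1/2}(x_{i,p})\Delta t,$$ for all $j$ and all $\Psi\in\mathcal D_k(\mathcal E_v)$ (with $\Psi$ evaluated at points of the cell $V_j$). This determines $f_h^{**}\in Q^k$. Step 3: $f_h^{m+1}$ is obtained from $f_h^{**}$ exactly as $f_h^*$ is obtained from $f_h^m$ in Step 1; $E_h^{m+1}$ is unchanged. Standing assumption (compact support in velocity, $v_m$ sufficiently large): at every time step and every node $x_{i,p}$, $f_h^*(x_{i,p},\cdot)$, extended by zero, vanishes (almost everywhere) outside $\bigcup_j V_j^\star=[-v_m+E_h^{m+1/2}(x_{i,p})\Delta t,\;v_m+E_h^{m+1/2}(x_{i,p})\Delta t]$, so no mass leaves the velocity domain. *)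

(* Defs.v *)
From HB Require Import structures.
From mathcomp Require Import all_boot all_order all_algebra.
From mathcomp Require Import all_classical all_reals all_analysis.

Set Implicit Arguments.
Unset Strict Implicit.
Unset Printing Implicit Defensive.

Import Order.TTheory GRing.Theory Num.Theory.
Import numFieldNormedType.Exports.

Local Open Scope classical_set_scope.
Local Open Scope ring_scope.

(* Cells are numbered from 0: cell [i] is [brk i, brk i.+1].  The values of
   [brk] beyond [ncell] are irrelevant. *)
Record mesh (R : realType) (a b : R) := Mesh {
  ncell : nat ;
  brk : nat -> R ;
  brk_first : brk 0%N = a ;
  brk_last : brk ncell = b ;
  brk_lt : forall i, (i < ncell)%N -> brk i < brk i.+1 }.

(* Rodrigues' formula. *)
Definition legendre (R : realType) (n : nat) : {poly R} :=
  (2 ^+ n * n`!%:R)^-1 *: (('X^2 - 1) ^+ n)^`(n).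

(* The Legendre polynomial has degree [n], so [n] distinct roots are all of
   its roots. *)
Record gauss_legendre (R : realType) (n : nat) := GaussLegendre {
  gl_node : 'I_n -> R ;
  gl_node_inj : injective gl_node ;
  gl_node_root : forall p, root (legendre R n) (gl_node p) }.

Section Quadrature.
Context (R : realType) (n : nat) (G : gauss_legendre R n).
Local Notation mu := (@lebesgue_measure R).

Definition lagrange_basis (p : 'I_n) : {poly R} :=
  \prod_(q < n | q != p)
    ((gl_node G p - gl_node G q)^-1 *: ('X - (gl_node G q)%:P)).

(* Interpolatory weights; at the roots of the Legendre polynomial the resulting
   rule on [-1, 1] is exact for polynomials of degree less than 2n. *)
Definition gl_weight (p : 'I_n) : R :=
  \int[mu]_(x in `[(-1 : R), 1]) (lagrange_basis p).[x].

Context (a b : R) (T : mesh a b).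

Definition cell_node (i : 'I_(ncell T)) (p : 'I_n) : R :=
  (brk T i + brk T i.+1) / 2 + (brk T i.+1 - brk T i) / 2 * gl_node G p.

Definition cell_weight (i : 'I_(ncell T)) (p : 'I_n) : R :=
  (brk T i.+1 - brk T i) / 2 * gl_weight p.

End Quadrature.

Section Spaces.
Context (R : realType) (k : nat).

(* Only the cell interiors are constrained: the function may be discontinuous
   at an interface, and its value there is left free.  Values outside [a, b]
   are irrelevant; the extensions below never read them. *)
Definition dg_space (a b : R) (T : mesh a b) : set (R -> R) :=
  [set g | forall i : 'I_(ncell T), exists P : {poly R},
     (size P <= k.+1)%N /\
     forall x, brk T i < x < brk T i.+1 -> g x = P.[x]].

Definition dg_tensor (a b c d : R) (Tx : mesh a b) (Tv : mesh c d) :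
    set (R -> R -> R) :=
  [set f | exists (n : nat) (g h : 'I_n -> R -> R),
     [/\ forall l, dg_space Tx (g l),
         forall l, dg_space Tv (h l) &
         forall x v, a <= x <= b -> c <= v <= d ->
           f x v = \sum_(l < n) g l x * h l v]].

End Spaces.

Definition periodic_ext (R : realType) (L : R) (g : R -> R) (x : R) : R :=
  g (x - (Num.floor (x / L))%:~R * L).

Definition zero_ext (R : realType) (vm : R) (g : R -> R) : R -> R :=
  g \_ `[- vm, vm].

Section Method.
Context (R : realType) (k : nat) (G : gauss_legendre R k.+1).
Context (L vm : R) (Tx : mesh 0 L) (Tv : mesh (- vm) vm).
Context (lambda dt : R).
Local Notation mu := (@lebesgue_measure R).
Local Notation xnode := (cell_node G (T := Tx)).
Local Notation vnode := (cell_node G (T := Tv)).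
Local Notation vweight := (cell_weight G (T := Tv)).

(* On both sides [Psi] is evaluated at points of cell [i] only: the test
   function itself needs no extension. *)
Definition x_advection (f f' : R -> R -> R) : Prop :=
  dg_tensor k Tx Tv f' /\
  forall (j : 'I_(ncell Tv)) (q : 'I_k.+1),
    let s := vnode j q * dt / 2 in
    forall (i : 'I_(ncell Tx)) (Psi : R -> R), dg_space k Tx Psi ->
      \int[mu]_(x in `[brk Tx i, brk Tx i.+1]) (f' x (vnode j q) * Psi x) =
      \int[mu]_(x in `[brk Tx i - s, brk Tx i.+1 - s])
        (periodic_ext L (f^~ (vnode j q)) x * Psi (x + s)).

Definition density (f : R -> R -> R) (x : R) : R :=
  \sum_(j < ncell Tv) \sum_(q < k.+1) vweight j q * f x (vnode j q).

Definition current (f : R -> R -> R) (x : R) : R :=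
  - \sum_(j < ncell Tv) \sum_(q < k.+1)
      vweight j q * f x (vnode j q) * vnode j q.

Definition theta (f : R -> R -> R) (x : R) : R := dt ^+ 2 / 4 * density f x.

(* Here [f] is the distribution after the first half transport in x. *)
Definition field_update (f : R -> R -> R) (E E' : R -> R) : Prop :=
  dg_space k Tx E' /\
  forall (i : 'I_(ncell Tx)) (p : 'I_k.+1),
    let x := xnode i p in
    lambda ^+ 2 + theta f x != 0 /\
    E' x = (lambda ^+ 2 - theta f x) / (lambda ^+ 2 + theta f x) * E x
           - dt / (lambda ^+ 2 + theta f x) * current f x.

Definition half_field (E E' : R -> R) (x : R) : R := 2^-1 * (E x + E' x).

Definition v_advection (Eh : R -> R) (f f' : R -> R -> R) : Prop :=
  dg_tensor k Tx Tv f' /\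
  forall (i : 'I_(ncell Tx)) (p : 'I_k.+1),
    let s := Eh (xnode i p) * dt in
    forall (j : 'I_(ncell Tv)) (Psi : R -> R), dg_space k Tv Psi ->
      \int[mu]_(v in `[brk Tv j, brk Tv j.+1]) (f' (xnode i p) v * Psi v) =
      \int[mu]_(v in `[brk Tv j + s, brk Tv j.+1 + s])
        (zero_ext vm (f (xnode i p)) v * Psi (v - s)).

(* [fs] and [fss] are the intermediate stages f* and f**. *)
Definition ecsldg_step (f : R -> R -> R) (E : R -> R) (fs fss : R -> R -> R)
    (f' : R -> R -> R) (E' : R -> R) : Prop :=
  [/\ x_advection f fs,
      field_update fs E E',
      v_advection (half_field E E') fs fss &
      x_advection fss f'].

Definition ecsldg (M : nat) (f : nat -> R -> R -> R) (E : nat -> R -> R)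
    (fs fss : nat -> R -> R -> R) : Prop :=
  [/\ dg_tensor k Tx Tv (f 0%N),
      dg_space k Tx (E 0%N) &
      forall m, (m < M)%N ->
        ecsldg_step (f m) (E m) (fs m) (fss m) (f m.+1) (E m.+1)].

Definition no_velocity_outflow (Eh : R -> R) (fs : R -> R -> R) : Prop :=
  forall (i : 'I_(ncell Tx)) (p : 'I_k.+1),
    let s := Eh (xnode i p) * dt in
    {ae mu, forall v : R,
      ~ (\bigcup_(j in [set: 'I_(ncell Tv)])
           `[brk Tv j + s, brk Tv j.+1 + s]%classic) v ->
      zero_ext vm (fs (xnode i p)) v = 0}.

Definition particle_number (f : R -> R -> R) : R :=
  \int[mu]_(x in `[0, L]) \int[mu]_(v in `[- vm, vm]) f x v.

End Method.

(* Main.v *)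
Require Import Defs.
From HB Require Import structures.
From mathcomp Require Import all_boot all_order all_algebra.
From mathcomp Require Import ring lra.
From mathcomp Require Import all_classical all_reals all_analysis.
From mathcomp Require Import measurable_realfun.

(** A discontinuous Galerkin scheme tested against the constant function 1
    only moves mass around: summing the weak form over all cells shows that one
    transport step along a line replaces the integral over that line by the
    integral of the extended function over the shifted line.  In x the extension
    is periodic, so the integral over any period is the same
    ([Rintegral_period]); in v the extension is by zero, and the shifted velocity
    window still carries the whole support ([Rintegral_ae_support]).

    The transport steps act, however, only on the lines through the
    Gauss-Legendre nodes, and the particle number is a double integral.  The
    two are linked by quadrature: on each cell the restriction of a function of
    the space has degree at most k, so the interpolatory rule at k+1 nodes is
    exact on it.  Hence the particle number is both a weighted sum of integrals
    over the lines v = v_(j,q) ([particle_number_xlines]) and a weighted sum of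
    integrals over the lines x = x_(i,p) ([particle_number_vlines]).  The first
    form is invariant under an x-step ([x_advection_conserves]), the second
    under the v-step ([v_advection_conserves]); a time step is the composition
    of three such steps, the field entering only through the shift, which may
    vary from one line to the next.

    Functions of the space are constrained in the interior of the cells only, so
    quadrature says nothing unless the nodes are interior, i.e. unless all the
    real roots of a Legendre polynomial lie in ]-1, 1[ ([gl_node_itv]).  This is
    read off from Rodrigues' formula: expanded around the endpoint 1 or -1, in
    the variable that grows outwards, (X^2 - 1)^n has nonnegative coefficients,
    the one of degree n being positive, so that its n-th derivative does not
    vanish outside ]-1, 1[. *)

Set Implicit Arguments.
Unset Strict Implicit.

Import Order.TTheory GRing.Theory Num.Theory.
Import numFieldNormedType.Exports.

Local Open Scope classical_set_scope.
Local Open Scope ring_scope.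

(** * Legendre polynomials have no root outside the open interval *)

Section LegendreRoots.
Context (R : realType).
Implicit Types (P : {poly R}).

Lemma derivn_comp_affine P (c d : R) n :
  (P \Po (c *: 'X + d%:P))^`(n) = c ^+ n *: (P^`(n) \Po (c *: 'X + d%:P)).
Proof.
elim: n => [|n IHn]; first by rewrite expr0 scale1r.
rewrite !derivnS IHn derivZ deriv_comp derivD derivZ derivX derivC addr0.
by rewrite alg_polyC mulrC mul_polyC scalerA exprSr.
Qed.

(** For c = 1 or c = -1, the map y |-> c y + c sends [0, +oo[ onto the half-line
    that starts at the endpoint c and points away from [-1, 1]. *)
Lemma rodrigues_at_endpoint (c : R) n : c ^+ 2 = 1 ->
  (('X^2 - 1) ^+ n) \Po (c *: 'X + c%:P) = 'X^n * ('X + 2%:P) ^+ n :> {poly R}.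
Proof.
move=> c2; rewrite rmorphXn/= -exprMn rmorphB rmorph1/= rmorphXn/= comp_polyX.
congr (_ ^+ _).
rewrite -alg_polyC -scalerDr exprZn c2 scale1r.
by rewrite rmorph_nat; ring.
Qed.

Lemma horner_ge_coef0 P (y : R) : (forall i, 0 <= P`_i) -> 0 <= y ->
  P`_0 <= P.[y].
Proof.
move=> P0 y0; rewrite horner_coef.
have [/eqP|] := posnP (size P).
  by rewrite size_poly_eq0 => /eqP ->; rewrite size_poly0 big_ord0 coef0.
case: (size P) => // n _; rewrite big_ord_recl expr0 mulr1 lerDl.
by apply: sumr_ge0 => i _; rewrite mulr_ge0 ?exprn_ge0.
Qed.

(** The n-th derivative of X^n (X + 2)^n has nonnegative coefficients and
    constant term n! 2^n, hence is positive on [0, +oo[. *)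
Lemma legendre_root_outside (c y : R) n : c ^+ 2 = 1 -> 0 <= y ->
  ~~ root (legendre R n) (c * y + c).
Proof.
move=> c2 y0; rewrite /legendre rootZ; last first.
  by rewrite invr_eq0 mulf_neq0 ?expf_neq0 ?pnatr_eq0 -?lt0n ?fact_gt0.
apply/negP => /rootP r0.
set g := 'X^n * ('X + 2%:P) ^+ n : {poly R}.
have X2_ge0 m i : 0 <= (('X + 2%:P) ^+ m : {poly R})`_i.
  elim: m i => [|m IHm] i; first by rewrite expr0 coef1 ler0n.
  rewrite exprSr mulrDr coefD coefMX coefMC addr_ge0 ?mulr_ge0//.
  by case: ifP.
have g_ge0 i : 0 <= g^`(n)`_i.
  by rewrite coef_derivn mulrn_wge0// coefXnM; case: ifP.
have := horner_ge_coef0 g_ge0 y0.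
rewrite /g -{2}(rodrigues_at_endpoint n c2) derivn_comp_affine.
rewrite hornerZ horner_comp !hornerE r0 mulr0.
rewrite coef_derivn addn0 coefXnM ltnn subnn ffactnn -horner_coef0.
rewrite !hornerE/= leNgt => /negP; apply.
by rewrite pmulrn_lgt0 ?fact_gt0// exprn_gt0.
Qed.

Lemma gl_node_itv n (G : gauss_legendre R n) p : -1 < gl_node G p < 1.
Proof.
have rt := gl_node_root G p.
apply/andP; split; rewrite ltNge; apply/negP => le.
- have := @legendre_root_outside (-1) (- gl_node G p - 1) n.
  rewrite sqrrN expr1n => /(_ erefl).
  rewrite (_ : _ * _ + _ = gl_node G p); last ring.
  by rewrite rt => H; have /H : 0 <= - gl_node G p - 1 by lra.
- have := @legendre_root_outside 1 (gl_node G p - 1) n.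
  rewrite expr1n => /(_ erefl).
  rewrite (_ : _ * _ + _ = gl_node G p); last ring.
  by rewrite rt subr_ge0 => /(_ le).
Qed.

End LegendreRoots.

(** * Interpolatory quadrature of polynomials *)

Section PolynomialQuadrature.
Context (R : realType).
Implicit Types (P : {poly R}).
Local Notation mu := (@lebesgue_measure R).

Lemma Rintegral_sum (I : Type) (r : seq I) (D : set R) (F : I -> R -> R) :
  measurable D -> (forall i, mu.-integrable D (EFin \o F i)) ->
  \int[mu]_(x in D) (\sum_(i <- r) F i x) =
  \sum_(i <- r) \int[mu]_(x in D) F i x.
Proof.
move=> mD iF; elim: r => [|i r IHr].
  by under eq_Rintegral do rewrite big_nil; rewrite big_nil Rintegral_cst// mul0r.
under eq_Rintegral do rewrite big_cons.
rewrite RintegralD//; first by rewrite big_cons IHr.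
have : mu.-integrable D (fun x => \sum_(i <- r) (F i x)%:E)%E.
  by apply: integrable_sum => // j _; exact: iF.
by apply: eq_integrable => // x _ /=; rewrite sumEFin.
Qed.

Lemma poly_integrable P (a b : R) : mu.-integrable `[a, b] (EFin \o horner P).
Proof.
apply: continuous_compact_integrable; first exact: segment_compact.
by apply: continuous_subspaceT; exact: continuous_horner.
Qed.

Lemma poly_antiderivative P : exists Q : {poly R}, Q^`() = P.
Proof.
(* At i = 0 the division by 0 gives 0; that coefficient is lost by derivation. *)
exists (\poly_(i < (size P).+1) (P`_i.-1 / i%:R)).
apply/polyP => i; rewrite coef_deriv coef_poly ltnS.
case: ltnP => [iP|/leq_sizeP/(_ i (leqnn _)) ->]; last by rewrite mul0rn.
by rewrite -[LHS]mulr_natr divfK// pnatr_eq0.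
Qed.

Lemma Rintegral_deriv_poly (Q : {poly R}) (a b : R) : a < b ->
  \int[mu]_(x in `[a, b]) (Q^`()).[x] = Q.[b] - Q.[a].
Proof.
move=> ab; rewrite /Rintegral (@continuous_FTC2 _ _ (horner Q)) => //.
- by apply: continuous_subspaceT; exact: continuous_horner.
- split=> [x _||]; first exact: derivable_horner.
  + by apply: cvg_at_right_filter; exact: continuous_horner.
  + by apply: cvg_at_left_filter; exact: continuous_horner.
- by move=> x _; rewrite -derivE.
Qed.

Lemma Rintegral_affine_poly P (m h : R) : 0 < h ->
  \int[mu]_(x in `[m - h, m + h]) P.[x] =
  h * \int[mu]_(y in `[-1, 1]) (P \Po (h *: 'X + m%:P)).[y].
Proof.
move=> h0; have [Q QP] := poly_antiderivative P.
have -> : P \Po (h *: 'X + m%:P) =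
    (h^-1 *: (Q \Po (h *: 'X + m%:P)))^`().
  rewrite derivZ -[_^`()]/(_^`(1)) derivn_comp_affine expr1 scalerA.
  by rewrite mulVf ?gt_eqF// scale1r derivn1 QP.
rewrite -QP !Rintegral_deriv_poly; [|lra|lra].
rewrite !(hornerE, horner_comp) -mulrBr mulVKf ?gt_eqF//.
by congr (_.[_] - _.[_]); ring.
Qed.

Context (n : nat) (G : gauss_legendre R n).

Lemma size_lagrange_basis p : (size (lagrange_basis G p) <= n)%N.
Proof.
rewrite /lagrange_basis; under eq_bigr do rewrite -mul_polyC.
rewrite big_split/= -rmorph_prod/= mul_polyC.
apply: leq_trans (size_scale_leq _ _) _.
rewrite -big_filter size_prod_XsubC size_filter -sum1_count sum1_card.
by rewrite cardC1 card_ord prednK// (leq_ltn_trans _ (ltn_ord p)).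
Qed.

Lemma lagrange_basis_node p q :
  (lagrange_basis G p).[gl_node G q] = (p == q)%:R.
Proof.
rewrite /lagrange_basis horner_prod; have [<-|pq] := eqVneq p q.
  apply: big1 => r rp; rewrite !hornerE mulVf// subr_eq0.
  by rewrite (inj_eq (@gl_node_inj _ _ G)) eq_sym.
by rewrite (bigD1 q) 1?eq_sym//= !hornerE subrr mulr0 mul0r.
Qed.

Lemma lagrange_interpolation P : (size P <= n)%N ->
  P = \sum_(p < n) P.[gl_node G p] *: lagrange_basis G p.
Proof.
move=> sP; apply/eqP; rewrite -subr_eq0; apply/eqP.
apply: (@roots_geq_poly_eq0 _ _ [seq gl_node G p | p <- enum 'I_n]).
- apply/allP => _ /mapP[q _ ->]; rewrite /root hornerD hornerN horner_sum.
  rewrite (bigD1 q)//= hornerZ lagrange_basis_node eqxx mulr1.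
  rewrite big1 ?addr0 ?subrr// => r rq.
  by rewrite hornerZ lagrange_basis_node (negbTE rq) mulr0.
- by rewrite map_inj_uniq ?enum_uniq//; exact: gl_node_inj.
- rewrite size_map size_enum_ord (leq_trans (size_polyD _ _))//.
  rewrite geq_max sP size_polyN (leq_trans (size_sum _ _ _))//.
  apply/bigmax_leqP => i _; apply: leq_trans (size_scale_leq _ _) _.
  exact: size_lagrange_basis.
Qed.

(** The weights integrate the Lagrange basis, and a polynomial of degree less
    than n is its own interpolant. *)
Lemma quadrature_poly P : (size P <= n)%N ->
  \int[mu]_(y in `[-1, 1]) P.[y] = \sum_(p < n) gl_weight G p * P.[gl_node G p].
Proof.
move=> sP; rewrite {1}(lagrange_interpolation sP).
under eq_Rintegral do rewrite horner_sum.
rewrite Rintegral_sum//; last by move=> p; exact: poly_integrable.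
apply: eq_bigr => p _; under eq_Rintegral do rewrite hornerZ.
by rewrite RintegralZl// 1?mulrC//; exact: poly_integrable.
Qed.

End PolynomialQuadrature.

(** * Translation invariance of the Lebesgue integral *)

Section Translation.
Context (R : realType).
Implicit Types (f g : R -> R) (a b c : R).
Local Notation mu := (@lebesgue_measure R).
Local Notation shift c :=
  (fun x : measurableTypeR R => (x + c : measurableTypeR R)).

Lemma measurable_fun_shift c : measurable_fun setT (shift c).
Proof. by apply: measurable_funD. Qed.

(** Lebesgue measure is characterized by its values on the half-open intervals,
    whose length is preserved. *)
Lemma lebesgue_measure_shift c (A : set R) : measurable A ->
  pushforward mu (shift c) A = mu A.
Proof.
move=> mA; apply/esym/lebesgue_measure_unique => //=.
  exact: measurable_fun_shift.
move=> _ _ [[a b]] _ <-; rewrite /pushforward.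
rewrite (_ : _ @^-1` _ = `]a - c, b - c]%classic); last first.
  by apply/seteqP; split => x /=; rewrite !in_itv/= ltrBlDr lerBrDr.
by rewrite !lebesgue_measure_itv/= !lte_fin ltrD2r -!EFinB opprB subrKA.
Qed.

Lemma integrable_shift f c : mu.-integrable setT (EFin \o f) ->
  mu.-integrable setT (EFin \o (fun x => f (x + c))).
Proof.
move=> /integrableP[mf intf]; apply/integrableP; split.
  apply/measurable_EFinP; apply: (measurableT_comp _ (measurable_fun_shift c)).
  exact/measurable_EFinP.
have mabs : measurable_fun setT (fun x => `|(EFin \o f) x|%E).
  exact: measurableT_comp.
have := ge0_integral_pushforward (measurable_fun_shift c) mu measurableT mabs.
rewrite preimage_setT => /(_ (fun _ _ => abse_ge0 _)) /= <-.
rewrite (eq_measure_integral mu)//; first exact: measurable_fun_shift.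
by move=> ms A mA _; exact: lebesgue_measure_shift.
Qed.

Lemma Rintegral_shift f c : mu.-integrable setT (EFin \o f) ->
  \int[mu]_x f (x + c) = \int[mu]_x f x.
Proof.
move=> intf; have [mf _] := integrableP _ _ _ intf.
have := @integral_pushforward _ _ _ _ _ _ (measurable_fun_shift c) mu _ _ mf
  (integrable_shift c intf) measurableT.
rewrite /Rintegral preimage_setT /= => <-.
congr fine; apply: eq_measure_integral => [|ms A mA _].
  exact: measurable_fun_shift.
exact: lebesgue_measure_shift.
Qed.

Lemma restrict_shift f a b c x :
  (f \_ `[a + c, b + c]) (x + c) = ((fun y => f (y + c)) \_ `[a, b]) x.
Proof. by rewrite !patchE !mem_setE !in_itv/= !lerD2r. Qed.

Lemma integrable_itv_shift f a b c :
  mu.-integrable `[a + c, b + c] (EFin \o f) ->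
  mu.-integrable `[a, b] (EFin \o (fun x => f (x + c))).
Proof.
move=> /integrable_mkcond; rewrite restrict_EFin => /(_ (measurable_itv _)).
move=> /(integrable_shift c) intf.
apply/integrable_mkcond; first exact: measurable_itv.
rewrite restrict_EFin; apply: eq_integrable intf => // x _.
by rewrite /= restrict_shift.
Qed.

Lemma Rintegral_itv_shift f a b c :
  mu.-integrable `[a + c, b + c] (EFin \o f) ->
  \int[mu]_(x in `[a, b]) f (x + c) = \int[mu]_(x in `[a + c, b + c]) f x.
Proof.
move=> intf; rewrite [LHS]Rintegral_mkcond [RHS]Rintegral_mkcond.
rewrite -[RHS](@Rintegral_shift _ c).
  by apply: eq_Rintegral => x _; rewrite restrict_shift.
rewrite -restrict_EFin; apply: (integrable_mkcond _ _).1 intf.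
exact: measurable_itv.
Qed.

End Translation.

(** * Splitting integrals, and integrals over a period *)

Section Gluing.
Context (R : realType).
Implicit Types (f g F : R -> R) (a b c : R).
Local Notation mu := (@lebesgue_measure R).

Lemma integrable_itv_sub f a b c d : c <= a -> b <= d ->
  mu.-integrable `[c, d] (EFin \o f) -> mu.-integrable `[a, b] (EFin \o f).
Proof.
move=> ca bd; apply: integrableS; [exact: measurable_itv..|].
by apply: subset_itv; rewrite bnd_simp.
Qed.

(** The middle point is removed from the second interval, so that the restriction
    of f to the union is the sum of its restrictions to the two pieces. *)
Lemma integrable_itv_cat f a b c : a <= b -> b <= c ->
  mu.-integrable `[a, b] (EFin \o f) -> mu.-integrable `[b, c] (EFin \o f) ->
  mu.-integrable `[a, c] (EFin \o f).
Proof.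
move=> ab bc fab fbc.
have fbc' : mu.-integrable `]b, c] (EFin \o f).
  by apply: integrableS fbc => //; apply: subset_itvr; rewrite bnd_simp.
apply/integrable_mkcond; first exact: measurable_itv.
move: fab fbc' => /integrable_mkcond fab /integrable_mkcond fbc'.
have {}fab := fab (measurable_itv _).
have {}fbc' := fbc' (measurable_itv _).
apply: eq_integrable (integrableD measurableT fab fbc') => // x _ /=.
rewrite !patchE !mem_setE !in_itv/=.
rewrite (_ : point = 0%E)//; have [xb|bx] := leP x b.
  by rewrite (le_trans xb bc) !andbT adde0.
by rewrite andbF add0e (le_trans ab (ltW bx)).
Qed.

Lemma Rintegral_itv_cat f a b c : a <= b -> b <= c ->
  mu.-integrable `[a, c] (EFin \o f) ->
  \int[mu]_(x in `[a, c]) f x =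
  \int[mu]_(x in `[a, b]) f x + \int[mu]_(x in `[b, c]) f x.
Proof.
move=> ab bc fac; apply/eqP; rewrite addrC -subr_eq; apply/eqP.
rewrite Rintegral_itvB ?bnd_simp//.
apply: Rintegral_itv_obnd_cbnd; apply: integrableS fac => //.
by apply: subset_itvr; rewrite bnd_simp.
Qed.

Lemma Rintegral_subdivision f (x : nat -> R) n :
  (forall i, (i < n)%N -> x i <= x i.+1) ->
  (forall i, (i < n)%N -> mu.-integrable `[x i, x i.+1] (EFin \o f)) ->
  mu.-integrable `[x 0%N, x n] (EFin \o f) /\
  \int[mu]_(t in `[x 0%N, x n]) f t =
  \sum_(i < n) \int[mu]_(t in `[x i, x i.+1]) f t.
Proof.
move=> xS intf.
(* The induction step also needs the endpoints to be ordered. *)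
suff [_ ? ?] : [/\ x 0%N <= x n, mu.-integrable `[x 0%N, x n] (EFin \o f) &
    \int[mu]_(t in `[x 0%N, x n]) f t =
    \sum_(i < n) \int[mu]_(t in `[x i, x i.+1]) f t] by [].
elim: n xS intf => [|n IHn] xS intf.
  rewrite set_itv1 big_ord0 Rintegral_set1 lexx; split => //.
  apply: null_set_integrable; [exact: measurable_set1|
    exact: measurable_fun_set1|exact: lebesgue_measure_set1].
have [i ni|i ni|x0n intn eqn] := IHn.
- by apply: xS; rewrite ltnW.
- by apply: intf; rewrite ltnW.
have xnS := xS n (ltnSn n).
have int0n := integrable_itv_cat x0n xnS intn (intf n (ltnSn n)).
split => //; first exact: le_trans xnS.
by rewrite big_ord_recr/= -eqn; exact: Rintegral_itv_cat.
Qed.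

(** Endpoints form a null set. This lets a function of the space be replaced by a
    polynomial on each cell, and a periodic extension by its original on the
    period. *)
Lemma eq_oo_Rintegral f g a b : (forall x, a < x < b -> f x = g x) ->
  mu.-integrable `[a, b] (EFin \o g) ->
  mu.-integrable `[a, b] (EFin \o f) /\
  \int[mu]_(x in `[a, b]) f x = \int[mu]_(x in `[a, b]) g x.
Proof.
move=> fg intg.
have goo : mu.-integrable `]a, b[ (EFin \o g).
  by apply: integrableS intg => //; apply: subset_itv; rewrite bnd_simp.
have foo : mu.-integrable `]a, b[ (EFin \o f).
  apply: eq_integrable goo => // x; rewrite inE/= in_itv/= => xab.
  by rewrite fg.
have mf := measurable_int _ foo.
split.
  apply/integrableP; split.
    exact: emeasurable_fun_itv_cc mf.
  have [_] := integrableP _ _ _ foo; apply: le_lt_trans.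
  by rewrite integral_itv_bndoo//; exact: measurableT_comp.
rewrite /Rintegral; congr fine.
rewrite [LHS]integral_itv_bndoo// [RHS]integral_itv_bndoo; last first.
  exact: measurable_int goo.
by apply: eq_integral => x; rewrite inE/= in_itv/= => /fg ->.
Qed.

(** Applied to the extension by zero of a velocity profile, A being the shifted
    velocity window, outside which it carries no mass. *)
Lemma Rintegral_ae_support (F : R -> R) (A : set R) : measurable A ->
  mu.-integrable setT (EFin \o F) ->
  {ae mu, forall v, ~ A v -> F v = 0} ->
  \int[mu]_(v in A) F v = \int[mu]_v F v.
Proof.
move=> mA intF aeF; rewrite Rintegral_mkcond /Rintegral; congr fine.
have mF := measurable_int _ intF.
apply: ae_eq_integral => //.
- have /(measurable_restrictT _ mA) : measurable_fun A (EFin \o F).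
    exact: measurable_funTS mF.
  by rewrite restrict_EFin.
- apply: negligibleS aeF => v /=; apply: contra_not => Fv _ /=.
  by rewrite patchE; case: ifPn => //; rewrite notin_setE => /Fv ->.
Qed.

Section Periodic.
Context (L : R) (hL : 0 < L).

Lemma periodic_extD g x : periodic_ext L g (x + L) = periodic_ext L g x.
Proof.
rewrite /periodic_ext mulrDl divff ?gt_eqF// floorDrz ?int_num1// floor1.
by rewrite intrD mulrDl mul1r opprD addrACA subrr addr0.
Qed.

Lemma periodic_ext_id g x : 0 <= x < L -> periodic_ext L g x = g x.
Proof.
move=> /andP[x0 xL]; rewrite /periodic_ext (@floor_def _ _ 0) ?mul0r ?subr0//.
by rewrite divr_ge0 ?(ltW hL)//= ltr_pdivrMr// mul1r.
Qed.

Lemma periodicDz F : (forall x, F (x + L) = F x) ->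
  forall (z : int) x, F (x + z%:~R * L) = F x.
Proof.
move=> FL; have FLn n x : F (x + n%:R * L) = F x.
  elim: n x => [|n IHn] x; first by rewrite mul0r addr0.
  by rewrite -natr1 mulrDl mul1r addrA FL.
case=> n x; first exact: FLn.
by rewrite NegzE mulrNz mulNr -[in RHS](subrK (n.+1%:R * L) x) FLn.
Qed.

(** The interval ]t, t + L] contains exactly one multiple of L, say s + L; the
    part beyond it, moved back by one period, completes [t, s + L] into the full
    period [s, s + L]. *)
Lemma Rintegral_period F t : (forall x, F (x + L) = F x) ->
  mu.-integrable `[0, L] (EFin \o F) ->
  mu.-integrable `[t, t + L] (EFin \o F) /\
  \int[mu]_(x in `[t, t + L]) F x = \int[mu]_(x in `[0, L]) F x.
Proof.
move=> FL intF; have FLz := periodicDz FL.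
have period z : mu.-integrable `[z%:~R * L, z%:~R * L + L] (EFin \o F) /\
    \int[mu]_(x in `[z%:~R * L, z%:~R * L + L]) F x =
    \int[mu]_(x in `[0, L]) F x.
  have eqF : (fun x => F (x + (- z)%:~R * L)) = F.
    by apply/funext => x; rewrite FLz.
  have := @integrable_itv_shift _ F (z%:~R * L) (z%:~R * L + L) ((- z)%:~R * L).
  have := @Rintegral_itv_shift _ F (z%:~R * L) (z%:~R * L + L) ((- z)%:~R * L).
  rewrite (_ : _ * L + L + _ = L) ?mulrNz; last ring.
  rewrite (_ : _ * L + - _ * L = 0); last ring.
  by rewrite -mulrNz eqF => /(_ intF) e /(_ intF) i; split.
set z := Num.floor (t / L); set s := z%:~R * L.
have /andP[st ts] : s <= t <= s + L.
  have /andP[zt tz] := floor_itv (t / L).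
  rewrite /s -ler_pdivlMr// zt/= -[leRHS]mul1r.
  by move: tz; rewrite ltr_pdivrMr// intrD mulrDl mul1r => /ltW; rewrite mul1r.
have [i1 e1] := period z; have [i2 _] := period (z + 1).
move: i2; rewrite (_ : (z + 1)%:~R * L = s + L); last first.
  by rewrite intrD mulrDl mul1r.
move: i1 e1; rewrite -/s; clearbody s => i1 e1 i2.
have iF : mu.-integrable `[s, s + L + L] (EFin \o F).
  by apply: integrable_itv_cat i1 i2; lra.
have itL : mu.-integrable `[t, t + L] (EFin \o F).
  by apply: integrable_itv_sub iF; lra.
split => //.
rewrite (@Rintegral_itv_cat _ _ (s + L))//; [|lra..].
rewrite -(@Rintegral_itv_shift _ F s t L); last first.
  by apply: integrable_itv_sub iF; lra.
under [X in _ + X]eq_Rintegral do rewrite FL.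
by rewrite addrC -Rintegral_itv_cat.
Qed.

End Periodic.

End Gluing.

(** * Discontinuous Galerkin functions on a mesh *)

Section Mesh.
Context (R : realType) (k : nat) (G : gauss_legendre R k.+1).
Context (a b : R) (T : mesh a b).
Local Notation mu := (@lebesgue_measure R).

Lemma brk_le i j : (i <= j <= ncell T)%N -> brk T i <= brk T j.
Proof.
move=> /andP[ij jT]; rewrite -(subnKC ij) in jT *.
elim: (j - i)%N jT => [|d IHd] jT; first by rewrite addn0.
rewrite addnS in jT *; apply: le_trans (IHd (ltnW jT)) _.
exact/ltW/brk_lt.
Qed.

Lemma brk_itv (i : 'I_(ncell T)) : a <= brk T i /\ brk T i.+1 <= b.
Proof.
split.
  by rewrite -[leLHS](brk_first T); apply: brk_le; exact: ltnW.
by rewrite -[leRHS](brk_last T); apply: brk_le; rewrite ltn_ord/=.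
Qed.

Lemma cell_node_interior (i : 'I_(ncell T)) p :
  brk T i < cell_node G i p < brk T i.+1.
Proof.
have := brk_lt (ltn_ord i); have /andP[] := gl_node_itv G p.
rewrite /cell_node => p1 p2 i1.
have : 0 < (brk T i.+1 - brk T i) / 2 by lra.
set h := (X in 0 < X) => h0.
have : - h < h * gl_node G p by rewrite -[ltLHS]mulrN1 ltr_pM2l.
have : h * gl_node G p < h by rewrite -[ltRHS]mulr1 ltr_pM2l.
move: (h * _) => y; rewrite /h => *; lra.
Qed.

Lemma cell_node_itv (i : 'I_(ncell T)) p : a <= cell_node G i p <= b.
Proof.
have [ai ib] := brk_itv i; have /andP[ip pi] := cell_node_interior i p.
by rewrite (le_trans ai (ltW ip)) (le_trans (ltW pi) ib).
Qed.

Lemma Rintegral_mesh f s :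
  mu.-integrable `[a + s, b + s] (EFin \o f) ->
  \sum_(i < ncell T) \int[mu]_(x in `[brk T i + s, brk T i.+1 + s]) f x =
  \int[mu]_(x in `[a + s, b + s]) f x.
Proof.
move=> intf.
have [i iT|i iT|_] :=
  @Rintegral_subdivision _ f (fun i => brk T i + s) (ncell T).
- by rewrite lerD2r ltW// brk_lt.
- have [ai ib] := brk_itv (Ordinal iT).
  by apply: integrable_itv_sub intf; rewrite lerD2r.
- by rewrite brk_first brk_last => ->.
Qed.

Lemma dg_space1 : dg_space k T (fun=> 1).
Proof. by move=> i; exists 1; split=> [|x _]; rewrite ?size_poly1 ?hornerE. Qed.

(** Only the polynomial that represents g inside the cell matters: the integral
    does not see the interfaces, and the nodes avoid them. *)
Lemma dg_space_cell g (i : 'I_(ncell T)) : dg_space k T g ->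
  mu.-integrable `[brk T i, brk T i.+1] (EFin \o g) /\
  \int[mu]_(x in `[brk T i, brk T i.+1]) g x =
  \sum_(p < k.+1) cell_weight G i p * g (cell_node G i p).
Proof.
move=> /(_ i)[P [sP gP]].
have [intg ->] := eq_oo_Rintegral gP (poly_integrable P _ _).
split => //; have ltb := brk_lt (ltn_ord i).
pose m := (brk T i + brk T i.+1) / 2; pose h := (brk T i.+1 - brk T i) / 2.
have h0 : 0 < h by rewrite /h; lra.
have -> : brk T i = m - h by rewrite /m /h; lra.
have -> : brk T i.+1 = m + h by rewrite /m /h; lra.
rewrite Rintegral_affine_poly// (quadrature_poly G); last first.
  rewrite size_comp_poly2//.
  by rewrite -mul_polyC size_MXaddC polyC_eq0 size_polyC gt_eqF.
rewrite mulr_sumr; apply: eq_bigr => p _.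
rewrite mulrA gP ?cell_node_interior// horner_comp !hornerE.
by congr (_ * _.[_]); rewrite /cell_node addrC.
Qed.

Lemma dg_space_integrable g : dg_space k T g ->
  mu.-integrable `[a, b] (EFin \o g).
Proof.
move=> gT; have [i iT|i iT|+ _] := @Rintegral_subdivision _ g (brk T) (ncell T).
- exact/ltW/brk_lt.
- exact: (dg_space_cell (Ordinal iT) gT).1.
- by rewrite brk_first brk_last.
Qed.

Lemma dg_space_quadrature g : dg_space k T g ->
  \int[mu]_(x in `[a, b]) g x =
  \sum_(c : 'I_(ncell T) * 'I_k.+1)
    cell_weight G c.1 c.2 * g (cell_node G c.1 c.2).
Proof.
move=> gT; have := @Rintegral_mesh g 0; rewrite !addr0 => <-; last first.
  exact: dg_space_integrable.
under eq_bigr => i _ do rewrite !addr0 (dg_space_cell i gT).2.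
by rewrite pair_bigA.
Qed.

Lemma dg_space_lincomb n (c : 'I_n -> R) (h : 'I_n -> R -> R) g :
  (forall l, dg_space k T (h l)) ->
  (forall x, a <= x <= b -> g x = \sum_(l < n) c l * h l x) ->
  dg_space k T g.
Proof.
move=> hT gE i; have [P hP] := choice (fun l => hT l i).
exists (\sum_(l < n) c l *: P l); split.
  apply: leq_trans (size_sum _ _ _) _; apply/bigmax_leqP => l _.
  exact: leq_trans (size_scale_leq _ _) (hP l).1.
move=> x xi; have [ai ib] := brk_itv i; have /andP[ix xi1] := xi.
rewrite gE ?(le_trans ai (ltW ix)) ?(le_trans (ltW xi1) ib)// horner_sum.
by apply: eq_bigr => l _; rewrite hornerZ (hP l).2.
Qed.

End Mesh.

(** * Conservation by the transport steps *)

Section Conservation.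
Context (R : realType) (k : nat) (G : gauss_legendre R k.+1).
Context (L vm : R) (Tx : mesh 0 L) (Tv : mesh (- vm) vm).
Implicit Types (f : R -> R -> R) (s dt : R).
Local Notation mu := (@lebesgue_measure R).
Local Notation xnode := (cell_node G (T := Tx)).
Local Notation vnode := (cell_node G (T := Tv)).
Local Notation xweight := (cell_weight G (T := Tx)).
Local Notation vweight := (cell_weight G (T := Tv)).

Lemma dg_tensor_vslice f x : dg_tensor k Tx Tv f -> 0 <= x <= L ->
  dg_space k Tv (f x).
Proof.
move=> [n [g [h [_ hT fE]]]] xL.
apply: (@dg_space_lincomb _ _ _ _ _ n (g^~ x) h) => // v vm_v.
exact: fE.
Qed.

Lemma dg_tensor_xslice f v : dg_tensor k Tx Tv f -> - vm <= v <= vm ->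
  dg_space k Tx (f^~ v).
Proof.
move=> [n [g [h [gT _ fE]]]] vE.
apply: (@dg_space_lincomb _ _ _ _ _ n (h^~ v) g) => // x xL.
by rewrite fE//; apply: eq_bigr => l _; rewrite mulrC.
Qed.

Lemma particle_number_xlines f : dg_tensor k Tx Tv f ->
  particle_number L vm f =
  \sum_(c : 'I_(ncell Tv) * 'I_k.+1)
    vweight c.1 c.2 * \int[mu]_(x in `[0, L]) f x (vnode c.1 c.2).
Proof.
move=> fT; transitivity (\int[mu]_(x in `[0, L])
    \sum_(c : 'I_(ncell Tv) * 'I_k.+1)
      vweight c.1 c.2 * f x (vnode c.1 c.2)).
  apply: eq_Rintegral => x; rewrite inE/= in_itv/= => xL.
  exact/dg_space_quadrature/dg_tensor_vslice.
have intf c : mu.-integrable `[0, L]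
    (EFin \o (fun x => f x (vnode c.1 c.2))).
  apply: (dg_space_integrable G).
  by apply: dg_tensor_xslice fT _; exact: cell_node_itv.
rewrite Rintegral_sum//=.
  by apply: eq_bigr => c _; rewrite RintegralZl.
move=> c; have intwf : mu.-integrable `[0, L]
    (fun x => (vweight c.1 c.2)%:E * (f x (vnode c.1 c.2))%:E)%E.
  by apply: integrableZl => //; exact: intf.
by apply: eq_integrable intwf => // x _; rewrite /= EFinM.
Qed.

(** Both forms equal the double quadrature sum over the nodes of the phase
    space, in which the two summations commute. *)
Lemma particle_number_vlines f : dg_tensor k Tx Tv f ->
  particle_number L vm f =
  \sum_(c : 'I_(ncell Tx) * 'I_k.+1)
    xweight c.1 c.2 * \int[mu]_(v in `[- vm, vm]) f (xnode c.1 c.2) v.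
Proof.
move=> fT; rewrite particle_number_xlines//.
under eq_bigr => c _.
  rewrite (@dg_space_quadrature _ _ G _ _ Tx (f^~ (vnode c.1 c.2))).
    rewrite mulr_sumr; over.
  by apply: dg_tensor_xslice fT _; exact: cell_node_itv.
rewrite exchange_big/=; apply: eq_bigr => c _.
rewrite (@dg_space_quadrature _ _ G _ _ Tv).
  by rewrite mulr_sumr; apply: eq_bigr => d _; rewrite mulrCA.
by apply: dg_tensor_vslice fT _; exact: cell_node_itv.
Qed.

(** The x-shift depends on v only, hence is constant on each line v = v_(j,q);
    on such a line the shifted cells tile one period of the extension. *)
Lemma x_advection_conserves dt f f' : 0 < L -> dg_tensor k Tx Tv f ->
  x_advection G Tx Tv dt f f' ->
  particle_number L vm f' = particle_number L vm f.
Proof.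
move=> L0 fT [f'T adv]; rewrite !particle_number_xlines//.
apply: eq_bigr => -[j q] _ /=; congr (_ * _).
have vin := cell_node_itv G j q.
have int1 h : dg_tensor k Tx Tv h ->
    mu.-integrable `[0, L] (EFin \o (h^~ (vnode j q))).
  by move=> hT; exact: (dg_space_integrable G) (dg_tensor_xslice hT vin).
set s := vnode j q * dt / 2.
pose F := periodic_ext L (f^~ (vnode j q)).
have F0L x : 0 < x < L -> F x = f x (vnode j q).
  by move=> /andP[x0 xL]; rewrite /F periodic_ext_id// (ltW x0).
have [intF intFE] := eq_oo_Rintegral F0L (int1 f fT).
have [intFs intFsE] := Rintegral_period L0 (- s) (periodic_extD L0 _) intF.
rewrite -intFE -intFsE.
have := @Rintegral_mesh _ _ _ Tx F (- s); rewrite add0r (addrC L) => <-//.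
have := @Rintegral_mesh _ _ _ Tx (f'^~ (vnode j q)) 0.
rewrite !addr0 => <-; last exact: int1.
apply: eq_bigr => i _; rewrite !addr0.
have := adv j q i (fun=> 1) (@dg_space1 _ _ _ _ _).
under eq_Rintegral do rewrite mulr1.
by move=> ->; apply: eq_Rintegral => x _; exact: mulr1.
Qed.

(** The v-shift is constant on each line x = x_(i,p), where the shifted cells
    tile the window [- vm + s, vm + s], which carries all the mass. *)
Lemma v_advection_conserves dt Eh f f' : dg_tensor k Tx Tv f ->
  v_advection G Tx Tv dt Eh f f' -> no_velocity_outflow G Tx Tv dt Eh f ->
  particle_number L vm f' = particle_number L vm f.
Proof.
move=> fT [f'T adv] outflow; rewrite !particle_number_vlines//.
apply: eq_bigr => -[i p] _ /=; congr (_ * _).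
have xin := cell_node_itv G i p.
have int1 h : dg_tensor k Tx Tv h ->
    mu.-integrable `[- vm, vm] (EFin \o h (xnode i p)).
  by move=> hT; exact: (dg_space_integrable G) (dg_tensor_vslice hT xin).
set s := Eh (xnode i p) * dt.
pose F := zero_ext vm (f (xnode i p)).
have intF : mu.-integrable setT (EFin \o F).
  rewrite /F /zero_ext -restrict_EFin.
  by apply: (integrable_mkcond _ _).1 (int1 f fT); exact: measurable_itv.
have -> : \int[mu]_(v in `[- vm, vm]) f (xnode i p) v =
    \int[mu]_(v in `[- vm + s, vm + s]) F v.
  rewrite Rintegral_mkcond; apply/esym/Rintegral_ae_support => //.
  apply: negligibleS (outflow i p) => v /=; apply: contra_not => Fv vA.
  apply: Fv => -[j _ /=].
  rewrite in_itv/= => /andP[jv vj]; apply: vA; rewrite /= in_itv/=.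
  have [] := brk_itv j; rewrite -(lerD2r s) -(lerD2r s _ vm) => jl jr.
  by rewrite (le_trans jl jv) (le_trans vj jr).
rewrite -(@Rintegral_mesh _ _ _ Tv F s); last first.
  exact: integrableS intF.
have := @Rintegral_mesh _ _ _ Tv (f' (xnode i p)) 0.
rewrite !addr0 => <-; last exact: int1.
apply: eq_bigr => j _; rewrite !addr0.
have := adv i p j (fun=> 1) (@dg_space1 _ _ _ _ _).
under eq_Rintegral do rewrite mulr1.
by move=> ->; apply: eq_Rintegral => x _; exact: mulr1.
Qed.

End Conservation.

Theorem proposition3p1 (R : realType) (k : nat) (G : gauss_legendre R k.+1)
  (L vm lambda dt : R) (hL : 0 < L) (hvm : 0 < vm)
  (hlambda : 0 < lambda) (hdt : 0 < dt)
  (Tx : mesh 0 L) (Tv : mesh (- vm) vm)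
  (M : nat) (f : nat -> R -> R -> R) (E : nat -> R -> R)
  (fs fss : nat -> R -> R -> R)
  (hgen : ecsldg G Tx Tv lambda dt M f E fs fss)
  (hsupp : forall m : nat, (m < M)%N ->
     no_velocity_outflow G Tx Tv dt (half_field (E m) (E m.+1)) (fs m)) :
  forall m : nat, (m < M)%N ->
    particle_number L vm (f m.+1) = particle_number L vm (f m).
Proof.
move=> m mM; have [f0T _ steps] := hgen.
have fT : dg_tensor k Tx Tv (f m).
  by case: m mM => // m mM; have [_ _ _ []] := steps m (ltnW mM).
have [step1 _ step2 step3] := steps m mM.
rewrite (x_advection_conserves hL step2.1 step3).
rewrite (v_advection_conserves step1.1 step2)//.
  exact: x_advection_conserves step1.
exact: hsupp.
Qed.
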